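(* Let $(\mathcal{H},d)$ be a Hadamard space and $(\mathcal{H}^n,d^n)_{n\in\mathbb{N}}$ a sequence of Hadamard spaces, and suppose an asymptotic relation between $(\mathcal{H}^n)$ and $\mathcal{H}$ is given. Let $f:\mathcal{H}\to(-\infty,\infty]$ and $f^n:\mathcal{H}^n\to(-\infty,\infty]$, $n\in\mathbb{N}$, be proper convex lower semicontinuous functions, with Moreau-Yosida envelopes $f_\lambda$, $f^n_\lambda$ and resolvents $J_\lambda$, $J^n_\lambda$, $\lambda>0$, respectively. Let $x\in\mathcal{H}$ and let $x_n\in\mathcal{H}^n$ with $x_n\to x$. If $f^n\to f$ in the sense of Mosco as $n\to\infty$, then $$\lim_{n\to\infty}f^n_\lambda(x_n)=f_\lambda(x)\quad\text{and}\quad\lim_{n\to\infty}J^n_\lambda(x_n)=J_\lambda(x)$$ for every $\lambda>0$.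
   Context: A Hadamard space is a complete geodesic metric space $(\mathcal{H},d)$ such that $d(x,\gamma(t))^2\le(1-t)d(x,\gamma(0))^2+t\,d(x,\gamma(1))^2-t(1-t)d(\gamma(0),\gamma(1))^2$ for every $x\in\mathcal{H}$, every (constant-speed) geodesic $\gamma:[0,1]\to\mathcal{H}$ and every $t\in[0,1]$. A function is convex if its composition with every geodesic $\gamma:[0,1]\to\mathcal{H}$ is convex; it is proper if it is not identically $\infty$. For a closed convex set $C$ (in particular the image of a geodesic), $P_C$ denotes the nearest-point projection onto $C$. For a proper convex lower semicontinuous function $f$ on a Hadamard space $(\mathcal{H},d)$ and $\lambda>0$, $f_\lambda(x)=\min_{y\in\mathcal{H}}\left[f(y)+\frac1{2\lambda}d(x,y)^2\right]$ and $J_\lambda(x)=\arg\min_{y\in\mathcal{H}}\left[f(y)+\frac1{2\lambda}d(x,y)^2\right]$ (the minimizer exists and is unique); for $f^n$ on $(\mathcal{H}^n,d^n)$ these are defined using $d^n$. Asymptotic relation: given a metric space $(X,d)$ and metric spaces $(X^n,d^n)_{n\in\mathbb{N}}$, let $\mathcal{X}=\left(\bigsqcup_{n}X^n\right)\sqcup X$ be the disjoint union. A topology on $\mathcal{X}$ is an asymptotic relation between $(X^n)$ and $X$ if: (A1) all $X^n$ and $X$ are closed in $\mathcal{X}$, and the topology of $\mathcal{X}$ restricted to each $X^n$ and to $X$ is its original topology; (A2) for every $x\in X$ there is a sequence $x^n\in X^n$ converging to $x$ in $\mathcal{X}$; (A3) if $x^n\in X^n$ converges to $x\in X$ and $y^n\in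 X^n$ converges to $y\in X$ in $\mathcal{X}$, then $d^n(x^n,y^n)\to d(x,y)$; (A4) if $x^n\in X^n$ converges to $x\in X$ in $\mathcal{X}$ and $y^n\in X^n$ satisfies $d^n(x^n,y^n)\to0$, then $y^n$ converges to $x$ in $\mathcal{X}$. For $x^n\in X^n$ and $x\in X$, $x^n\to x$ means convergence in $\mathcal{X}$. A sequence $x^n\in X^n$ is bounded if there is a convergent sequence $y^n\in X^n$ such that $d^n(x^n,y^n)$ is bounded. Geodesics $\gamma^n:[0,1]\to\mathcal{H}^n$ converge to a geodesic $\gamma:[0,1]\to\mathcal{H}$ if $\gamma^n(0)\to\gamma(0)$ and $\gamma^n(1)\to\gamma(1)$. A bounded sequence $x^n\in\mathcal{H}^n$ weakly converges to $x\in\mathcal{H}$, written $x^n\stackrel{w}{\to}x$, if for every sequence of geodesics $\gamma^n:[0,1]\to\mathcal{H}^n$ converging to a geodesic $\gamma:[0,1]\to\mathcal{H}$ with $\gamma(0)=x$ one has $P_{\gamma^n}(x^n)\to x$. Mosco convergence: $f^n\to f$ in the sense of Mosco if, for every $x\in\mathcal{H}$, (M1) $f(x)\le\liminf_{n\to\infty}f^n(x_n)$ whenever $x_n\in\mathcal{H}^n$ and $x_n\stackrel{w}{\to}x$, and (M2) there exist $y_n\in\mathcal{H}^n$ with $y_n\to x$ and $f^n(y_n)\to f(x)$. *)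

(* Defs.v *)
From HB Require Import structures.
From mathcomp Require Import all_boot all_order all_algebra.
From mathcomp Require Import all_classical all_reals.
From mathcomp Require Import topology ereal normedtype sequences.

Set Implicit Arguments.
Unset Strict Implicit.
Unset Printing Implicit Defensive.

Import Order.TTheory GRing.Theory Num.Theory.
Import numFieldNormedType.Exports.

Local Open Scope classical_set_scope.
Local Open Scope ring_scope.

Section Hadamard.
Context {R : realType} {H : metricType R}.

(* Constant-speed geodesics [0, 1] -> H; the values of g outside [0, 1] are
   irrelevant. *)
Definition geodesic (g : R -> H) : Prop :=
  {in `[0, 1]%R &, forall s t,
    mdist (g s) (g t) = `|s - t| * mdist (g 0) (g 1)}.

Definition geodesic_image (g : R -> H) : set H := g @` `[0, 1].

(* A nearest point of C to x (the point x itself if there is none). For a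
   nonempty closed convex subset C of a Hadamard space it exists and is
   unique. *)
Definition proj (C : set H) (x : H) : H :=
  xget x [set y | C y /\ forall z, C z -> mdist x y <= mdist x z].

Definition convex (f : H -> \bar R) : Prop :=
  forall g : R -> H, geodesic g ->
  forall a b t, a \in `[0, 1]%R -> b \in `[0, 1]%R -> t \in `[0, 1]%R ->
    (f (g ((1 - t) * a + t * b)%R)
       <= (1 - t)%:E * f (g a) + t%:E * f (g b))%E.

Record proper_convex_lsc (f : H -> \bar R) : Prop := ProperConvexLsc {
  pcl_ninfty : forall x, f x != -oo%E ;
  pcl_proper : exists x, f x != +oo%E ;
  pcl_convex : convex f ;
  pcl_lsc : lower_semicontinuous f }.

Definition prox_obj (f : H -> \bar R) (lambda : R) (x y : H) : \bar R :=
  (f y + ((2 * lambda)^-1 * mdist x y ^+ 2)%:E)%E.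

(* The infimum is attained when f is proper, convex and lower semicontinuous
   on a Hadamard space and lambda > 0. *)
Definition moreau_env (f : H -> \bar R) (lambda : R) (x : H) : \bar R :=
  ereal_inf (range (prox_obj f lambda x)).

(* Under the same assumptions the minimizer exists and is unique; the default
   value x of xget is then not used. *)
Definition resolvent (f : H -> \bar R) (lambda : R) (x : H) : H :=
  xget x [set y | forall z, (prox_obj f lambda x y <= prox_obj f lambda x z)%E].

End Hadamard.

Record hadamard (R : realType) (H : metricType R) : Prop := IsHadamard {
  hadamard_complete :
    forall F : set_system H, ProperFilter F -> cauchy F ->
      exists x : H, F --> x ;
  hadamard_geodesic : forall x y : H,
    exists g : R -> H, [/\ geodesic g, g 0 = x & g 1 = y] ;
  hadamard_CAT0 : forall (x : H) (g : R -> H) (t : R),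
    geodesic g -> t \in `[0, 1]%R ->
    mdist x (g t) ^+ 2 <= (1 - t) * mdist x (g 0) ^+ 2
      + t * mdist x (g 1) ^+ 2 - t * (1 - t) * mdist (g 0) (g 1) ^+ 2 }.

Section DisjointUnion.
Variables (R : realType) (X_ : nat -> metricType R) (X : metricType R).

Inductive dunion : Type :=
  | in_seq (n : nat) of X_ n
  | in_lim of X.

(* An arbitrary topology on the disjoint union, given by its open sets; it
   need not be the coproduct topology. *)
Record dunion_topology : Type := DunionTopology {
  dt_op : set_system dunion ;
  dt_opT : dt_op setT ;
  dt_opI : setI_closed dt_op ;
  dt_op_bigU : forall (I : Type) (U : I -> set dunion),
    (forall i, dt_op (U i)) -> dt_op (\bigcup_i U i) }.

Definition dspace (tau : dunion_topology) : Type := dunion.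

End DisjointUnion.

Arguments in_seq {R X_ X} n _.
Arguments in_lim {R X_ X} _.

HB.instance Definition _ (R : realType) (X_ : nat -> metricType R)
  (X : metricType R) (tau : dunion_topology X_ X) :=
  gen_eqMixin (dspace tau).
HB.instance Definition _ (R : realType) (X_ : nat -> metricType R)
  (X : metricType R) (tau : dunion_topology X_ X) :=
  gen_choiceMixin (dspace tau).
HB.instance Definition _ (R : realType) (X_ : nat -> metricType R)
  (X : metricType R) (tau : dunion_topology X_ X) :=
  isOpenTopological.Build (dspace tau)
    (dt_opT tau) (@dt_opI _ _ _ tau) (@dt_op_bigU _ _ _ tau).

Section Asymptotic.
Context {R : realType} {X_ : nat -> metricType R} {X : metricType R}.
Variable tau : dunion_topology X_ X.

Definition from_seq (n : nat) (x : X_ n) : dspace tau := in_seq n x.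
Definition from_lim (x : X) : dspace tau := in_lim x.

Definition seq_cvg (x_ : forall n, X_ n) (x : X) : Prop :=
  (fun n => from_seq (x_ n)) @ \oo --> from_lim x.

Record asymptotic_relation : Prop := AsymptoticRelation {
  asym_closed_seq : forall n, closed (range (@from_seq n)) ;
  asym_closed_lim : closed (range from_lim) ;
  asym_induced_seq : forall n (U : set (X_ n)),
    open U <-> exists2 V, open V & U = @from_seq n @^-1` V ;
  asym_induced_lim : forall U : set X,
    open U <-> exists2 V, open V & U = from_lim @^-1` V ;
  asym_dense : forall x : X, exists x_, seq_cvg x_ x ;
  asym_dist : forall x_ x y_ y, seq_cvg x_ x -> seq_cvg y_ y ->
    (fun n => mdist (x_ n) (y_ n)) @ \oo --> mdist x y ;
  asym_close : forall x_ x (y_ : forall n, X_ n), seq_cvg x_ x ->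
    (fun n => mdist (x_ n) (y_ n)) @ \oo --> (0 : R) -> seq_cvg y_ x }.

Definition seq_bounded (x_ : forall n, X_ n) : Prop :=
  exists (y_ : forall n, X_ n) (y : X), seq_cvg y_ y /\
    exists M : R, forall n, mdist (x_ n) (y_ n) <= M.

Definition geodesic_cvg (g_ : forall n, R -> X_ n) (g : R -> X) : Prop :=
  seq_cvg (fun n => g_ n 0) (g 0) /\ seq_cvg (fun n => g_ n 1) (g 1).

Definition weak_cvg (x_ : forall n, X_ n) (x : X) : Prop :=
  seq_bounded x_ /\
  forall (g_ : forall n, R -> X_ n) (g : R -> X),
    (forall n, geodesic (g_ n)) -> geodesic g -> geodesic_cvg g_ g ->
    g 0 = x -> seq_cvg (fun n => proj (geodesic_image (g_ n)) (x_ n)) x.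

Definition mosco_cvg (f_ : forall n, X_ n -> \bar R) (f : X -> \bar R) : Prop :=
  forall x : X,
    (forall x_, weak_cvg x_ x -> (f x <= limn_einf (fun n => f_ n (x_ n)))%E) /\
    (exists2 y_, seq_cvg y_ x & (fun n => f_ n (y_ n)) @ \oo --> f x).

End Asymptotic.

(* Main.v *)
(* Strong convexity of the proximal objectives makes resolvents exist, and
   reduces their convergence to that of the envelopes: the value of the n-th
   objective at a Mosco recovery sequence [y_n] of the resolvent exceeds its
   minimum by at least a multiple of the squared distance from [y_n] to the
   minimizer. The upper bound on the envelopes is (M2). For the lower bound,
   suppose the n-th objectives have, for infinitely many n, values at [w_n]
   definitely below the limit envelope; moving [w_n] along geodesics towards
   [y_n] one may assume [w_n] bounded. A subsequence with all asymptotic radii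
   of its subsequences equal converges weakly to its asymptotic center, and
   completing it by a convergent sequence gives a full sequence to which (M1)
   applies; together with the weak lower semicontinuity of the distance this
   contradicts the definition of the limit envelope. *)
Require Import Defs.
From mathcomp Require Import all_boot all_order all_algebra.
From mathcomp Require Import all_classical all_reals.
From mathcomp Require Import topology ereal normedtype sequences.
From mathcomp Require Import derive.
From mathcomp Require Import ring lra.

Set Implicit Arguments.
Unset Strict Implicit.
Unset Printing Implicit Defensive.

Import Order.TTheory GRing.Theory Num.Theory.
Import numFieldNormedType.Exports.

Local Open Scope classical_set_scope.
Local Open Scope ring_scope.

(** * Geodesics, nearest points and strong convexity *)

Section SingleSpace.
Context {R : realType} {H : metricType R}.
Implicit Types (g : R -> H) (x y z w : H).

Lemma comb01 (a b t : R) : a \in `[0, 1] -> b \in `[0, 1] -> t \in `[0, 1] ->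
  (1 - t) * a + t * b \in `[0, 1].
Proof.
rewrite !in_itv/= => /andP[? ?] /andP[? ?] /andP[? ?].
by apply/andP; split; nra.
Qed.

Lemma geodesic_sub g (a b : R) : geodesic g -> a \in `[0, 1] -> b \in `[0, 1] ->
  geodesic (fun u => g ((1 - u) * a + u * b)).
Proof.
move=> gg ha hb s t hs ht /=.
rewrite (_ : (1 - 0) * a + 0 * b = a); last by ring.
rewrite (_ : (1 - 1) * a + 1 * b = b); last by ring.
rewrite (gg _ _ (comb01 ha hb hs) (comb01 ha hb ht)) (gg a b ha hb).
rewrite mulrA -normrM (_ : _ - _ = (s - t) * (b - a)); last by ring.
by rewrite !normrM (distrC b).
Qed.

Lemma cat0_sub (hadH : hadamard H) g x (a b t : R) : geodesic g ->
  a \in `[0, 1] -> b \in `[0, 1] -> t \in `[0, 1] ->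
  mdist x (g ((1 - t) * a + t * b)) ^+ 2 <= (1 - t) * mdist x (g a) ^+ 2
    + t * mdist x (g b) ^+ 2 - t * (1 - t) * mdist (g a) (g b) ^+ 2.
Proof.
move=> gg ha hb ht.
have := hadamard_CAT0 hadH x (geodesic_sub gg ha hb) ht.
rewrite (_ : (1 - 0) * a + 0 * b = a); last by ring.
by rewrite (_ : (1 - 1) * a + 1 * b = b); last by ring.
Qed.

Lemma mdist_le_add x y z (a b : R) :
  mdist x y <= a -> mdist y z <= b -> mdist x z <= a + b.
Proof. by move=> xy yz; rewrite (le_trans (metric_triangle x y z))// lerD. Qed.

(** Completeness in the form that both existence proofs use, with [T e] a set of [e]-almost
    minimizers. The limit is merely approximated by points of each [T e]; that it is optimal takes a
    further (semi)continuity argument in each use. *)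
Lemma cauchy_nested (hadH : hadamard H) (T : R -> set H) :
  (forall e, 0 < e -> T e !=set0) ->
  (forall e e', 0 < e -> e <= e' -> T e `<=` T e') ->
  (forall d, 0 < d -> exists2 e, 0 < e &
    forall y z, T e y -> T e z -> mdist y z < d) ->
  exists x, forall d e, 0 < d -> 0 < e -> exists2 y, T e y & mdist x y < d.
Proof.
move=> T0 Tle Td.
pose F : set_system H := filter_from [set e : R | 0 < e] T.
have FF : ProperFilter F.
  apply: filter_from_proper; last by move=> e /T0.
  apply: filter_from_filter; first by exists 1 => /=.
  move=> e e' /= e0 e'0; exists (Num.min e e'); first by rewrite /= lt_min e0.
  have m0 : 0 < Num.min e e' by rewrite lt_min e0.
  by move=> y Ty; split; apply: Tle Ty => //; rewrite ge_min lexx ?orbT.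
have Fc : cauchy F.
  apply/cauchy_ballP => d d0; have [e e0 Te] := Td _ d0.
  exists (T e, T e) => /=; first by split; exists e.
  by move=> [y z] /= [Ty Tz]; rewrite ballEmdist /=; exact: Te.
have [x Fx] := hadamard_complete hadH FF Fc; exists x => d e d0 e0.
have /= [e' e'0 Te'] := Fx _ (nbhsx_ballx x d d0).
have m0 : 0 < Num.min e e' by rewrite lt_min e0.
have [y Ty] := T0 _ m0; exists y.
  by apply: Tle Ty => //; rewrite ge_min lexx.
have : ball x d y by apply: Te'; apply: Tle Ty => //; rewrite ge_min lexx orbT.
by rewrite ballEmdist.
Qed.

Lemma geodesic_proj g w : geodesic g -> exists t, [/\ t \in `[0, 1],
  Defs.proj (geodesic_image g) w = g t &
  forall s, s \in `[0, 1] -> mdist w (g t) <= mdist w (g s)].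
Proof.
move=> gg.
(* [g] is arbitrary outside the unit interval; composing with the 1-Lipschitz [clamp] makes the
   distance to [w] continuous on the whole line, so that the extreme value theorem applies. *)
pose clamp (s : R) := Num.max 0 (Num.min 1 s).
have clampE s : s \in `[0, 1] -> clamp s = s.
  by rewrite in_itv /= /clamp => /andP[s0 s1]; rewrite min_r// max_r.
have clampP s : [\/ s <= 0 /\ clamp s = 0, 0 <= s <= 1 /\ clamp s = s |
    1 <= s /\ clamp s = 1].
  have [s0|s0] := leP s 0.
    by apply: Or31; split => //; rewrite /clamp max_l// ge_min s0 orbT.
  have [s1|s1] := leP s 1.
    by apply: Or32; rewrite clampE ?in_itv /= (ltW s0)// s1.
  by apply: Or33; rewrite (ltW s1) /clamp min_l ?(ltW s1)// max_r.
have clamp01 s : clamp s \in `[0, 1].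
  by rewrite in_itv /=; case: (clampP s) => -[s01 ->]; rewrite ?lexx ?ler01.
have clampL s t : `|clamp s - clamp t| <= `|s - t|.
  have h1 := ler_norm (s - t); have := ler_norm (t - s); rewrite distrC => h2.
  rewrite ler_norml; case: (clampP s) => -[? ->]; case: (clampP t) => -[? ->];
  by apply/andP; split; lra.
pose L := mdist (g 0) (g 1).
have L0 : 0 <= L by exact: mdist_ge0.
pose h s := mdist w (g (clamp s)).
have hL s t : `|h s - h t| <= L * `|s - t|.
  have hD : mdist (g (clamp s)) (g (clamp t)) <= L * `|s - t|.
    by rewrite gg// mulrC ler_wpM2l.
  have h1 := metric_triangle w (g (clamp s)) (g (clamp t)).
  have h2 := metric_triangle w (g (clamp t)) (g (clamp s)).
  rewrite (metric_sym (g (clamp t))) in h2.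
  by rewrite ler_norml /h; apply/andP; split; lra.
have ch : continuous h.
  move=> s; apply/cvgrPdist_lt => e e0; near=> t.
  rewrite (le_lt_trans (hL _ _))//.
  (* [L + 1] instead of [L] covers constant geodesics. *)
  have : `|s - t| < e / (L + 1).
    near: t; apply/nbhs_ballP; exists (e / (L + 1)) => //=.
    by rewrite divr_gt0// ltr_wpDl.
  rewrite ltr_pdivlMr ?ltr_wpDl// => /(le_lt_trans _); apply.
  have := normr_ge0 (s - t); nra.
have [t t01 tmin] := EVT_min (@ler01 R) (continuous_subspaceT ch).
rewrite /h clampE// in tmin.
have {}tmin s : s \in `[0, 1] -> mdist w (g t) <= mdist w (g s).
  by move=> s01; have := tmin _ s01; rewrite clampE.
have [y [[r r01 ry] yP]] : exists y, [set y | geodesic_image g y /\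
    forall z, geodesic_image g z -> mdist w y <= mdist w z] y.
  by exists (g t); split=> [|_ [s s01 <-]]; [exists t | exact: tmin].
rewrite /Defs.proj; case: xgetP => [_ _ [[s s01 <-] sP]|/(_ y)[]]; last first.
  by split=> //; exists r.
by exists s; split => // u u01; apply: sP; exists u.
Unshelve. all: by end_near. Qed.

(** The CAT(0) inequality makes the squared distance strongly convex, and adding a convex [f] keeps
    the quadratic term. Real bounds [a] and [b] in place of the values at the endpoints keep
    infinities out of the arithmetic. *)
Lemma prox_obj_geodesic (hadH : hadamard H) (f : H -> \bar R) (lambda : R) x g
    (t a b : R) : 0 < lambda -> Defs.convex f -> geodesic g -> t \in `[0, 1] ->
  (prox_obj f lambda x (g 0%R) <= a%:E)%E ->
  (prox_obj f lambda x (g 1%R) <= b%:E)%E ->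
  (prox_obj f lambda x (g t) <= ((1 - t) * a + t * b
     - (2 * lambda)^-1 * (t * (1 - t) * mdist (g 0) (g 1) ^+ 2))%R%:E)%E.
Proof.
move=> l0 cf gg ht; rewrite /prox_obj => h0 h1.
have k0 : 0 <= (2 * lambda)^-1 by rewrite invr_ge0; lra.
set k := (2 * lambda)^-1 in k0 h0 h1 *.
move: h0; rewrite -leeBrDr//; rewrite -EFinB => h0.
move: h1; rewrite -leeBrDr//; rewrite -EFinB => h1.
have := cf g gg 0 1 t; rewrite !in_itv /= !lexx ler01 => /(_ isT isT ht).
rewrite mulr0 add0r mulr1 => cft.
have := hadamard_CAT0 hadH x gg ht.
move: ht; rewrite in_itv /= => /andP[t0 t1] hc.
rewrite -leeBrDr// -EFinB (le_trans cft)//.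
apply: (@le_trans _ _ ((1 - t)%:E * (a - k * mdist x (g 0) ^+ 2)%:E +
  t%:E * (b - k * mdist x (g 1) ^+ 2)%:E)%E).
  by apply: leeD; apply: lee_wpmul2l; rewrite // lee_fin; lra.
rewrite -!EFinM -EFinD lee_fin.
have := ler_wpM2l k0 hc; lra.
Qed.

End SingleSpace.

(** * Resolvents *)

Section Resolvent.
Context {R : realType} {H : metricType R}.
Variables (hadH : hadamard H) (f : H -> \bar R) (hf : proper_convex_lsc f).
Variables (lambda : R) (l0 : 0 < lambda) (x : H).
Local Notation k := ((2 * lambda)^-1).

Let k0 : 0 < k. Proof. by rewrite invr_gt0 mulr_gt0. Qed.

Let lsc_ball p (a : R) : (a%:E < f p)%E ->
  exists2 r, 0 < r & forall y, mdist p y < r -> (a%:E < f y)%E.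
Proof.
move=> /(pcl_lsc hf)[V /nbhs_ballP[r /= r0 rV] Va]; exists r => // y py.
by apply/Va/rV; rewrite ballEmdist.
Qed.

(* Near a point [p] of its domain [f] exceeds [f p - 1]. A value of the
   objective far below this would, by strong convexity along the geodesic
   from [p], violate that bound near [p]. *)
Lemma prox_obj_lower_bound :
  exists a : R, forall y, (a%:E <= prox_obj f lambda x y)%E.
Proof.
have [p fp] := pcl_proper hf; have {}fp : f p \is a fin_num.
  by rewrite fin_numE fp (pcl_ninfty hf).
set c0 := fine (f p); have c0E : f p = c0%:E by rewrite fineK.
have [r r0 rP] : exists2 r, 0 < r & forall y, mdist p y < r ->
    ((c0 - 1)%:E < f y)%E.
  by apply: lsc_ball; rewrite c0E lte_fin; lra.
have D0 : 0 <= k * mdist x p ^+ 2 by rewrite mulr_ge0 ?sqr_ge0// ltW.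
set c := c0 + k * mdist x p ^+ 2; set e := 1 + k * mdist x p ^+ 2.
have e0 : 0 < e by rewrite /e; lra.
(* The first summand serves [z] close to [p], where [t = 1 / 2] gives [t * K >= e]; the second
   serves distant [z], with [t * d = r / 2]. *)
pose K := 2 * e + 8 * e ^+ 2 / (k * r ^+ 2).
exists (c - K) => z; rewrite leNgt; apply/negP => Fz.
have [g [gg g0 g1]] := hadamard_geodesic hadH p z.
pose d := mdist p z; have d0 : 0 <= d by exact: mdist_ge0.
(* Such a point [g t] lies in the ball around [p], but its objective is at most [c - e = c0 - 1],
   and so is [f (g t)]. *)
suff [t [t0 t1 td tP]] : exists t, [/\ 0 <= t, t <= 1 / 2, t * d < r &
    e <= t * K + k * (t * (1 - t) * d ^+ 2)].
  have t01 : t \in `[0, 1] by rewrite in_itv /= t0; lra.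
  have h0 : (prox_obj f lambda x (g 0%R) <= c%:E)%E.
    by rewrite g0 /prox_obj c0E -EFinD.
  have h1 : (prox_obj f lambda x (g 1%R) <= (c - K)%:E)%E by rewrite g1 ltW.
  have := prox_obj_geodesic hadH l0 (pcl_convex hf) gg t01 h0 h1.
  rewrite g0 g1 -/d /prox_obj => Fw.
  have pw : mdist p (g t) < r.
    by rewrite -g0 gg ?in_itv/= ?lexx ?ler01// g0 g1 sub0r normrN ger0_norm.
  have := rP _ pw; apply/negP; rewrite -leNgt.
  move: Fw; rewrite -leeBrDr// -EFinB => /le_trans; apply; rewrite lee_fin.
  have := sqr_ge0 (mdist x (g t)) => /(mulr_ge0 (ltW k0)).
  by move: tP; rewrite /c /e; lra.
have K0 : 0 <= 8 * e ^+ 2 / (k * r ^+ 2).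
  by rewrite divr_ge0 ?mulr_ge0 ?sqr_ge0// ltW.
have [dr|rd] := leP d r.
  exists (1 / 2); split; [lra|lra|lra|].
  have : 0 <= k * (1 / 2 * (1 - 1 / 2) * d ^+ 2).
    by rewrite mulr_ge0 ?(ltW k0)// mulr_ge0 ?sqr_ge0//; lra.
  rewrite /K; lra.
have {}d0 : 0 < d by lra.
exists (r / (2 * d)); set t := r / (2 * d).
have td : t * d = r / 2 by rewrite /t; field; rewrite gt_eqF.
have t0 : 0 < t by rewrite divr_gt0// mulr_gt0.
have t1 : t <= 1 / 2 by rewrite ler_pdivrMr ?mulr_gt0//; lra.
clearbody t.
split; [exact: ltW| by []|lra|].
have kr : 0 < k * r by rewrite mulr_gt0.
have s1 : k * (t * (1 - t) * d ^+ 2) >= k * r * d / 4.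
  rewrite (_ : _ * (t * _ * _) = k * d * (t * d) * (1 - t)); last by ring.
  rewrite td; have : 0 <= k * d * r by rewrite !mulr_ge0// ltW.
  nra.
have s2 : 4 * e ^+ 2 <= t * K * (k * r * d).
  rewrite /K mulrDr mulrDl.
  rewrite (_ : t * (8 * e ^+ 2 / (k * r ^+ 2)) * (k * r * d) =
      8 * e ^+ 2 / r * (t * d)).
    rewrite td (_ : 8 * e ^+ 2 / r * (r / 2) = 4 * e ^+ 2); last first.
      by field; rewrite gt_eqF.
    by rewrite lerDr ltW // !mulr_gt0.
  by field; rewrite !gt_eqF.
have tK : 0 <= t * K by rewrite mulr_ge0 ?(ltW t0)// /K; lra.
(* The summands [t * K] and at least [k * r * d / 4] cannot both be below [e], since
   [t * K * (k * r * d)] is at least [4 * e ^+ 2]. *)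
rewrite leNgt; apply/negP => h.
have krd : 0 <= k * r * d by rewrite !mulr_ge0// ltW.
have : t * K < e by lra.
have : k * r * d < 4 * e by lra.
nra.
Qed.

(** By strong convexity the sets of almost minimizers shrink to a point; lower semicontinuity makes
    that point a minimizer. *)
Lemma prox_obj_min : exists z (m : R), prox_obj f lambda x z = m%:E /\
  forall y, (m%:E <= prox_obj f lambda x y)%E.
Proof.
have [a aP] := prox_obj_lower_bound.
pose S : set R := [set b | exists y, (prox_obj f lambda x y <= b%:E)%E].
have Sa : lbound S a.
  by move=> b [y yb]; rewrite -lee_fin (le_trans (aP y)).
have S0 : S !=set0.
  have [p fp] := pcl_proper hf; have {}fp : f p \is a fin_num.
    by rewrite fin_numE fp (pcl_ninfty hf).
  exists (fine (f p) + k * mdist x p ^+ 2); exists p.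
  by rewrite /prox_obj EFinD fineK.
have iS : has_inf S by split => //; exists a.
set m := inf S; have mP b y : (prox_obj f lambda x y <= b%:E)%E -> m <= b.
  by move=> yb; apply: ge_inf; [exists a | exists y].
have mF y : (m%:E <= prox_obj f lambda x y)%E.
  move: (mP ^~ y); case: (prox_obj f lambda x y) (aP y) => [b||] //= _.
  - by move=> h; rewrite lee_fin h.
  - by rewrite leey.
pose T e : set H := [set y | (prox_obj f lambda x y <= (m + e)%:E)%E].
have [||d d0|z zP] := @cauchy_nested _ _ hadH T.
- move=> e e0; have [b [y yb] bm] := inf_adherent e0 iS.
  by exists y; rewrite /T/= (le_trans yb)// lee_fin ltW.
- by move=> e e' e0 ee' y /le_trans; apply; rewrite lee_fin lerD2l.
(* For points at distance at least [d] the midpoint gains [k * d ^+ 2 / 4], twice this tolerance,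
   and would fall below [m]. *)
- exists (k * d ^+ 2 / 8); first by rewrite divr_gt0// mulr_gt0// exprn_gt0.
  move=> y z Ty Tz; have [g [gg g0 g1]] := hadamard_geodesic hadH y z.
  have h01 : 1 / 2 \in `[0, 1 : R] by rewrite in_itv /=; apply/andP; split; lra.
  rewrite /T/= -g0 in Ty; rewrite /T/= -g1 in Tz.
  have /mP := prox_obj_geodesic hadH l0 (pcl_convex hf) gg h01 Ty Tz.
  rewrite g0 g1 => h; rewrite ltNge; apply/negP => dyz.
  have {}dyz : k * d ^+ 2 <= k * mdist y z ^+ 2.
    by rewrite ler_wpM2l ?(ltW k0)// ler_sqr ?nnegrE ?mdist_ge0// ltW.
  have : 0 < k * d ^+ 2 by rewrite mulr_gt0// exprn_gt0.
  lra.
exists z, m; split => //; apply/eqP; rewrite eq_le mF andbT leNgt; apply/negP.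
set D := mdist x z; have D0 : 0 <= D by exact: mdist_ge0.
rewrite {1}/prox_obj -/D -lteBlDr// -EFinB => mz.
have [eta e0 ez] : exists2 eta, 0 < eta & ((m - k * D ^+ 2 + eta)%:E < f z)%E.
  move: mz; case: (f z) (pcl_ninfty hf z) => [b||] // _.
    rewrite lte_fin => mb; exists ((b - (m - k * D ^+ 2)) / 2); first by lra.
    by rewrite lte_fin; lra.
  by move=> _; exists 1; rewrite // ltry.
have [r r0 rP] := lsc_ball ez.
(* With this [d], replacing [z] by a point [y] within [d] lowers the quadratic term by less than
   [eta / 2], while [y] in [T (eta / 4)] and the bound on [f y] force a drop of more than
   [3 * eta / 4]. *)
pose d := eta / (4 * k * (D + 1)).
have dd0 : 0 < 4 * k * (D + 1) by rewrite !mulr_gt0//; lra.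
have d0 : 0 < d by rewrite divr_gt0.
have md : 0 < Num.min r d by rewrite lt_min r0.
have e40 : 0 < eta / 4 by lra.
have [y Ty] := zP _ _ md e40; rewrite lt_min => /andP[/rP fy zyd].
have : ((m - k * D ^+ 2 + eta + k * mdist x y ^+ 2)%:E < (m + eta / 4)%:E)%E.
  apply: lt_le_trans Ty; rewrite /prox_obj EFinD lteD2rE//.
rewrite lte_fin => h.
have Dy : D - d <= mdist x y.
  by have := metric_triangle x y z; rewrite (metric_sym y) -/D; lra.
have Dsq : D ^+ 2 - 2 * d * D <= mdist x y ^+ 2.
  have [Dd|dD] := leP D d; first by have := sqr_ge0 (mdist x y); nra.
  nra.
have := ler_wpM2l (ltW k0) Dsq.
have : d * (4 * k * (D + 1)) = eta by rewrite divfK// gt_eqF.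
have : 0 < d * k by rewrite mulr_gt0.
nra.
Qed.

Lemma resolventP : exists m : R, [/\ moreau_env f lambda x = m%:E,
  prox_obj f lambda x (resolvent f lambda x) = m%:E &
  forall y, (m%:E <= prox_obj f lambda x y)%E].
Proof.
have [z [m [zm mP]]] := prox_obj_min; exists m.
have rm : prox_obj f lambda x (resolvent f lambda x) = m%:E.
  rewrite /resolvent; case: xgetP => [y _ /= yP|/(_ z)[] y]; last by rewrite zm.
  by apply/eqP; rewrite eq_le mP -zm yP.
split => //; apply/eqP; rewrite eq_le; apply/andP; split.
  by rewrite -zm; apply: ereal_inf_lbound; exists z.
by apply: le_ereal_inf_tmp => _ [y _ <-].
Qed.

(** Strong convexity at the midpoint between resolvent and [y], where the objective is still at
    least [m]. *)
Lemma resolvent_quadratic_growth y (b m : R) :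
  moreau_env f lambda x = m%:E -> (prox_obj f lambda x y <= b%:E)%E ->
  k / 2 * mdist (resolvent f lambda x) y ^+ 2 <= b - m.
Proof.
have [m' [-> rm mP]] := resolventP => -[mm yb]; rewrite {m'}mm in rm mP.
have [g [gg g0 g1]] := hadamard_geodesic hadH (resolvent f lambda x) y.
have h01 : 1 / 2 \in `[0, 1 : R] by rewrite in_itv /=; apply/andP; split; lra.
have h0 : (prox_obj f lambda x (g 0%R) <= m%:E)%E by rewrite g0 rm.
have h1 : (prox_obj f lambda x (g 1%R) <= b%:E)%E by rewrite g1.
have := prox_obj_geodesic hadH l0 (pcl_convex hf) gg h01 h0 h1.
by move=> /(le_trans (mP _)); rewrite lee_fin g0 g1; lra.
Qed.

End Resolvent.

(** * Asymptotic centers and weak convergence *)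

(** If the projection were farther from [g 1] than [w] is, moving it slightly towards [g 1] would
    bring it closer to [w]. This is the source of the weak lower semicontinuity of the distance. *)
Lemma proj_endpoint (R : realType) (H : metricType R) (hadH : hadamard H)
    (g : R -> H) (w : H) : geodesic g ->
  mdist (Defs.proj (geodesic_image g) w) (g 1) <= mdist w (g 1).
Proof.
move=> gg; have [t [t01 -> tP]] := geodesic_proj w gg.
rewrite leNgt; apply/negP => WP.
have W0 := mdist_ge0 w (g 1).
set W := mdist w (g 1) in WP W0; set P := mdist (g t) (g 1) in WP.
have WP2 : W ^+ 2 < P ^+ 2 by rewrite ltr_pXn2r ?nnegrE //; lra.
have P1 : 0 < P by lra.
have P0 : 0 < P ^+ 2 by rewrite exprn_gt0.
(* The minimizer of [u * W ^+ 2 - u * (1 - u) * P ^+ 2], which is negative there because [W < P]. *)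
pose u := (P ^+ 2 - W ^+ 2) / (2 * P ^+ 2).
have uP : u * P ^+ 2 = (P ^+ 2 - W ^+ 2) / 2.
  by rewrite /u; field; rewrite gt_eqF.
have W20 := sqr_ge0 W.
have u0 : 0 < u by rewrite divr_gt0//; lra.
have u1 : u <= 1 by rewrite ler_pdivrMr; lra.
have u01 : u \in `[0, 1] by rewrite in_itv /= u1 ltW.
have o01 : 1 \in `[0, 1 : R] by rewrite in_itv /= lexx ler01.
have := cat0_sub hadH w gg t01 o01 u01.
have /tP : (1 - u) * t + u * 1 \in `[0, 1] by exact: comb01.
rewrite -ler_sqr ?nnegrE ?mdist_ge0// => h1 /(le_trans h1).
by have := sqr_ge0 (mdist w (g t)); rewrite -/W -/P; nra.
Qed.

(** Subsequences are encoded as infinite sets of indices, so that no reindexing of the dependent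
    family of spaces is needed. *)
Definition cofinal (A : set nat) := forall N, exists2 n, (N <= n)%N & A n.

Lemma not_near_cofinal (P : nat -> Prop) :
  ~ (\forall n \near \oo, P n) -> cofinal [set n | ~ P n].
Proof.
move=> nP N; apply: contrapT => h; apply: nP; exists N => // n /= Nn.
by apply: contrapT => nPn; apply: h; exists n.
Qed.

Lemma cofinal_near (A : set nat) (P : nat -> Prop) :
  cofinal A -> (\forall n \near \oo, P n) -> cofinal [set n | A n /\ P n].
Proof.
move=> cA [M _ MP] N; have [n Nn An] := cA (maxn M N).
exists n; first by rewrite (leq_trans _ Nn)// leq_maxr.
by split => //; apply: MP; rewrite /= (leq_trans _ Nn)// leq_maxl.
Qed.

Lemma cofinal_ex (A : set nat) (P : nat -> Prop) :
  cofinal A -> (\forall n \near \oo, P n) -> exists2 n, A n & P n.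
Proof. by move=> cA /(cofinal_near cA) /(_ 0)[n _ [An Pn]]; exists n. Qed.

(* Nested choice of almost minimal sets followed by a diagonal argument. *)
Lemma regular_subset (R : realType) (rho : set nat -> R) (A0 : set nat) :
  (forall A, 0 <= rho A) ->
  (forall A B, (\forall n \near \oo, A n -> B n) -> rho A <= rho B) ->
  cofinal A0 -> exists A, [/\ cofinal A, A `<=` A0 &
    forall B, cofinal B -> B `<=` A -> rho B = rho A].
Proof.
move=> rho0 rhoS cA0.
pose T := {A : set nat | cofinal A}.
have step (p : nat * T) : exists B : T, sval B `<=` sval p.2 /\
    forall C, cofinal C -> C `<=` sval p.2 ->
      rho (sval B) <= rho C + p.1.+1%:R^-1.
  case: p => k [A cA] /=.
  pose S := [set rho C | C in [set C | cofinal C /\ C `<=` A]].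
  have iS : has_inf S.
    split; first by exists (rho A); exists A => //; split => // ?.
    by exists 0 => _ [C _ <-]; exact: rho0.
  have k0 : 0 < k.+1%:R^-1 :> R by rewrite invr_gt0 ltr0n.
  have [_ [B [cB BA] <-] Bk] := inf_adherent k0 iS.
  exists (exist _ B cB); split => // C cC CA; rewrite (le_trans (ltW Bk))//.
  by rewrite lerD2r; apply: ge_inf; [exact: iS.2 | exists C].
have [next nextP] := choice step.
pose A_ := fix A_ k : T :=
  if k is k'.+1 then next (k', A_ k') else exist _ A0 cA0.
have AS k j : (k <= j)%N -> sval (A_ j) `<=` sval (A_ k).
  elim: j => [|j IH]; first by rewrite leqn0 => /eqP -> n.
  rewrite leq_eqVlt => /orP[/eqP -> n //|kj].
  by apply: subset_trans (IH kj); exact: (nextP _).1.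
have ex k : exists n, (k <= n)%N /\ sval (A_ k) n.
  by have [n kn An] := svalP (A_ k) k; exists n.
have [pick pickP] := choice ex.
(* The diagonal set: beyond the finitely many [pick j] with [j < k] it lies inside [A_ k]. *)
pose D := [set n | exists k, n = pick k].
have DA k : \forall n \near \oo, D n -> sval (A_ k) n.
  exists (\max_(j < k) pick j).+1 => // n /= Mn [j nj].
  have [kj|jk] := leqP k j.
    by apply: (AS _ _ kj); rewrite nj; case: (pickP j).
  move: Mn; rewrite nj ltnNge => /negP[].
  exact: (@leq_bigmax_cond _ _ (fun j : 'I_k => pick j) (Ordinal jk)).
exists D; split.
- by move=> k; exists (pick k); [case: (pickP k) | exists k].
- by move=> _ [k ->]; apply: (AS 0%N k) => //; case: (pickP k).
move=> B cB BD; apply/eqP; rewrite eq_le; apply/andP; split.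
  by apply: rhoS; apply: nearW => n /BD.
apply/ler_addgt0Pr => e e0.
have [k kP] : exists k, k.+1%:R^-1 < e.
  have [k _ kP] := near_infty_natSinv_lt (PosNum e0).
  by exists k; apply: kP => /=.
pose C := [set n | B n /\ sval (A_ k) n].
(* [C] competes in the choice of [A_ k.+1], hence [rho D <= rho (A_ k.+1) <= rho C + k.+1%:R^-1],
   and [rho C <= rho B]. *)
have cC : cofinal C.
  have near : \forall n \near \oo, D n -> sval (A_ k) n by exact: DA.
  move=> N; have [n Nn [Bn An]] := cofinal_near cB near N.
  by exists n => //; split=> //; apply/An/BD.
have CA : C `<=` sval (A_ k) by move=> n [].
have h1 := (nextP (k, A_ k)).2 C cC CA.
have h2 : rho D <= rho (sval (next (k, A_ k))) by apply: rhoS; exact: (DA k.+1).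
have h3 : rho C <= rho B by apply: rhoS; apply: nearW => n [].
move: h1 kP => /=; move: (k.+1%:R^-1) => q h1 qe; lra.
Qed.

Lemma cvg_sqr (R : realType) (u : nat -> R) (l : R) :
  u @ \oo --> l -> (fun n => u n ^+ 2) @ \oo --> l ^+ 2.
Proof.
by move=> ul; rewrite expr2; under eq_fun do rewrite expr2; exact: cvgM.
Qed.

(** * Convergence of geodesics and weak lower semicontinuity of the distance *)

Section Asymptotic.
Context {R : realType} {H_ : nat -> metricType R} {H : metricType R}.
Variables (hadH : hadamard H) (hadH_ : forall n, hadamard (H_ n)).
Variables (tau : dunion_topology H_ H) (asym : asymptotic_relation tau).

Lemma seq_cvg_near (x_ y_ : forall n, H_ n) x : seq_cvg tau x_ x ->
  (forall e, 0 < e -> \forall n \near \oo, mdist (x_ n) (y_ n) <= e) ->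
  seq_cvg tau y_ x.
Proof.
move=> xx xy; apply: (asym_close asym xx); apply/cvgrPdist_le => e /xy.
by apply: filterS => n; rewrite sub0r normrN ger0_norm ?mdist_ge0.
Qed.

Lemma seq_cvg_dist_lt (x_ y_ : forall n, H_ n) x :
  seq_cvg tau x_ x -> seq_cvg tau y_ x ->
  forall e, 0 < e -> \forall n \near \oo, mdist (x_ n) (y_ n) < e.
Proof.
move=> xx yx e e0; have := asym_dist asym xx yx; rewrite mdistxx.
move=> /cvgrPdist_lt/(_ _ e0); apply: filterS => n.
by rewrite sub0r normrN ger0_norm ?mdist_ge0.
Qed.

(** For [u n] tending to [g s], CAT(0) bounds the squared distance from [u n] to [g_ n s] by [E n].
    By (A3) [E n] tends to the same expression on [g], which vanishes since [g s] lies on [g]. *)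
Lemma geodesic_cvg_at (g_ : forall n, R -> H_ n) (g : R -> H) (s : R) :
  (forall n, geodesic (g_ n)) -> geodesic g -> geodesic_cvg tau g_ g ->
  s \in `[0, 1] -> seq_cvg tau (fun n => g_ n s) (g s).
Proof.
move=> gg_ gg [c0 c1] s01; have [u us] := asym_dense asym (g s).
apply: (seq_cvg_near us) => e e0.
pose E n := (1 - s) * mdist (u n) (g_ n 0) ^+ 2 + s * mdist (u n) (g_ n 1) ^+ 2
   - s * (1 - s) * mdist (g_ n 0) (g_ n 1) ^+ 2.
have E0 : E n @[n --> \oo] --> (0 : R).
  have -> : 0 = (1 - s) * mdist (g s) (g 0) ^+ 2 + s * mdist (g s) (g 1) ^+ 2
     - s * (1 - s) * mdist (g 0) (g 1) ^+ 2.
    rewrite (gg s 0) ?in_itv/= ?lexx ?ler01//.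
    rewrite [mdist (g s) (g 1)](gg s 1) ?in_itv/= ?lexx ?ler01//.
    by rewrite subr0 !exprMn !real_normK ?num_real//; ring.
  have := asym_dist asym c0 c1; have := asym_dist asym us c1.
  have := asym_dist asym us c0 => /cvg_sqr d0 /cvg_sqr d1 /cvg_sqr d2.
  by apply: cvgB; first apply: cvgD; (apply: cvgM; [exact: cvg_cst | ]).
have e2 : 0 < e ^+ 2 by rewrite exprn_gt0.
move/cvgrPdist_lt/(_ _ e2): E0; apply: filterS => n.
rewrite sub0r normrN => /(le_lt_trans (ler_norm _)) En.
have := hadamard_CAT0 (hadH_ n) (u n) (gg_ n) s01.
move=> /le_lt_trans/(_ En); rewrite ltr_pXn2r ?nnegrE ?mdist_ge0 ?(ltW e0)//.
exact: ltW.
Qed.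

Lemma geodesics_between (x_ y_ : forall n, H_ n) :
  exists g_ : forall n, R -> H_ n,
  forall n, [/\ geodesic (g_ n), g_ n 0 = x_ n & g_ n 1 = y_ n].
Proof.
have h n := hadamard_geodesic (hadH_ n) (x_ n) (y_ n).
by exists (fun n => projT1 (cid (h n))) => n; case: cid.
Qed.

Lemma geodesics_between_cvg (x_ y_ : forall n, H_ n) x y :
  seq_cvg tau x_ x -> seq_cvg tau y_ y -> exists (g_ : forall n, R -> H_ n) g,
  [/\ forall n, [/\ geodesic (g_ n), g_ n 0 = x_ n & g_ n 1 = y_ n],
    forall n, geodesic (g_ n), geodesic g /\ geodesic_cvg tau g_ g,
    g 0 = x & g 1 = y].
Proof.
move=> xx yy; have [g [gg g0 g1]] := hadamard_geodesic hadH x y.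
have [g_ g_P] := geodesics_between x_ y_; exists g_, g; split => //.
  by move=> n; case: (g_P n).
split => //; rewrite /geodesic_cvg g0 g1.
rewrite (_ : (fun n => g_ n 0) = x_); last first.
  by apply: functional_extensionality_dep => n; case: (g_P n).
rewrite (_ : (fun n => g_ n 1) = y_)//.
by apply: functional_extensionality_dep => n; case: (g_P n).
Qed.

(** Along geodesics from points tending to [z] towards [x_ n], the projections of [w n] tend to [z],
    and by [proj_endpoint] they are no farther from [x_ n] than [w n] is. *)
Lemma weak_cvg_dist (w x_ : forall n, H_ n) z x :
  weak_cvg tau w z -> seq_cvg tau x_ x ->
  forall e, 0 < e -> \forall n \near \oo, mdist z x - e <= mdist (w n) (x_ n).
Proof.
move=> [_ wz] xx e e0.
have [a az] := asym_dense asym z.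
have [g_ [g [g_P gg_ [gg gc] g0 g1]]] := geodesics_between_cvg az xx.
have pz := wz g_ g gg_ gg gc g0.
have := asym_dist asym pz xx => /cvgrPdist_lt/(_ _ e0).
apply: filterS => n; have [gn _ gn1] := g_P n.
have := proj_endpoint (hadH_ n) (w n) gn; rewrite gn1 => h.
by move=> /(le_lt_trans (ler_norm _)); lra.
Qed.

(** * Asymptotic radii and centers of subsequences *)

Section Centers.
Variables (a : H -> forall n, H_ n) (aP : forall x, seq_cvg tau (a x) x).
Variable w : forall n, H_ n.

(** A point [y] of the limit space is compared with [w n] through the chosen sequence [a y]
    converging to it; another choice costs an arbitrarily small increase of [c]. *)
Definition admissible (A : set nat) (c : R) (y : H) :=
  \forall n \near \oo, A n -> mdist (w n) (a y n) <= c.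

Definition radius (A : set nat) : R :=
  inf [set c | 0 <= c /\ exists y, admissible A c y].

Definition is_center (A : set nat) (x : H) :=
  forall c, radius A < c -> admissible A c x.

Hypothesis wb : exists c y, admissible setT c y.

Let radius_has_inf A : has_inf [set c | 0 <= c /\ exists y, admissible A c y].
Proof.
split; last by exists 0 => c [].
have [c [y cy]] := wb; exists `|c|; split => //; exists y.
apply: filterS cy => n /(_ Logic.I) wc _.
by rewrite (le_trans wc)// ler_norm.
Qed.

Lemma radius_ge0 A : 0 <= radius A.
Proof. by apply: lb_le_inf; [exact: (radius_has_inf A).1 | move=> c []]. Qed.

Lemma radius_le A c y : 0 <= c -> admissible A c y -> radius A <= c.
Proof.
move=> c0 cy; apply: ge_inf; first exact: (radius_has_inf A).2.
by split => //; exists y.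
Qed.

Lemma radius_mono A B :
  (\forall n \near \oo, A n -> B n) -> radius A <= radius B.
Proof.
move=> AB; apply: lb_le_inf; first exact: (radius_has_inf B).1.
move=> c [c0 [y cy]]; apply: (@radius_le A c y) => //.
by apply: filterS2 AB cy => n AB cy /AB.
Qed.

Lemma admissible_of_cvg A (v : forall n, H_ n) y c c' : c < c' ->
  seq_cvg tau v y -> (\forall n \near \oo, A n -> mdist (w n) (v n) <= c) ->
  admissible A c' y.
Proof.
move=> cc vy wv; have cc0 : 0 < c' - c by lra.
apply: filterS2 wv (seq_cvg_dist_lt vy (@aP y) cc0) => n wv h An.
by have := mdist_le_add (wv An) (ltW h); rewrite subrKC.
Qed.

(** Transfers CAT(0) estimates, which bound squares, to the radius. *)
Lemma radius_sqr_le A (v : forall n, H_ n) y (q_ : nat -> R) (q : R) :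
  cofinal A -> seq_cvg tau v y -> q_ @ \oo --> q ->
  (\forall n \near \oo, A n -> mdist (w n) (v n) ^+ 2 <= q_ n) ->
  radius A ^+ 2 <= q.
Proof.
move=> cA vy qq wv.
have q0 : 0 <= q.
  rewrite leNgt; apply/negP => q0.
  have [n An [h1 h2]] := cofinal_ex cA (filterI wv (cvgr_lt _ qq _ q0)).
  by have := h1 An; have := sqr_ge0 (mdist (w n) (v n)); lra.
rewrite leNgt; apply/negP => qr.
have r0 := radius_ge0 A; set r := radius A in qr r0.
have s0 := sqrtr_ge0 q; have sq := sqr_sqrtr q0; set s := Num.sqrt q in s0 sq.
have sr : s < r by rewrite -sq ltr_pXn2r ?nnegrE in qr.
(* [c] leaves room above [s] for the convergence of [q_], and below [r] for passing from [v] to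
   [a y]. *)
pose c := (s + r) / 2.
have c0 : 0 <= c by rewrite /c; lra.
have qc : q < c ^+ 2 by rewrite -sq ltr_pXn2r ?nnegrE// /c; lra.
have cr : c < (c + r) / 2 by rewrite /c; lra.
suff : admissible A ((c + r) / 2) y.
  by move=> /radius_le; rewrite -/r /c => h; have := h _; lra.
apply: (admissible_of_cvg cr vy).
apply: filterS2 wv (cvgr_lt _ qq _ qc) => n wv qn An.
by rewrite -ler_sqr ?nnegrE ?mdist_ge0// (le_trans (wv An))// ltW.
Qed.

(** The midpoints of [a y n] and [a z n] converge, so they compete for the radius, and CAT(0) makes
    them closer to [w n] by the quadratic term. *)
Lemma admissible_mdist A c y z : cofinal A ->
  admissible A c y -> admissible A c z ->
  mdist y z ^+ 2 / 4 <= c ^+ 2 - radius A ^+ 2.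
Proof.
move=> cA cy cz.
have [g_ [g [g_P gg_ [gg gc] g0 g1]]] := geodesics_between_cvg (@aP y) (@aP z).
have h01 : 1 / 2 \in `[0, 1 : R] by rewrite in_itv /=; apply/andP; split; lra.
have gm := geodesic_cvg_at gg_ gg gc h01.
have qq : (fun n => c ^+ 2 - mdist (a y n) (a z n) ^+ 2 / 4) @ \oo -->
    c ^+ 2 - mdist y z ^+ 2 / 4.
  apply: cvgB; first exact: cvg_cst.
  apply: cvgM; last exact: cvg_cst.
  exact/cvg_sqr/(asym_dist asym (@aP y) (@aP z)).
suff : radius A ^+ 2 <= c ^+ 2 - mdist y z ^+ 2 / 4 by lra.
apply: (radius_sqr_le cA gm qq).
apply: filterS2 cy cz => n wy wz An.
have [gn g0n g1n] := g_P n.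
have := hadamard_CAT0 (hadH_ n) (w n) gn h01; rewrite g0n g1n.
have sq u : mdist (w n) u <= c -> mdist (w n) u ^+ 2 <= c ^+ 2.
  move=> h; rewrite ler_sqr ?nnegrE ?mdist_ge0//.
  by rewrite (le_trans _ h)// mdist_ge0.
by have := sq _ (wy An); have := sq _ (wz An); lra.
Qed.

Lemma admissible_diam A d : cofinal A -> 0 < d -> exists2 e, 0 < e &
  forall y z, admissible A (radius A + e) y -> admissible A (radius A + e) z ->
    mdist y z < d.
Proof.
move=> cA d0; have r0 := radius_ge0 A.
have rd0 : 0 < 8 * (2 * radius A + 1) by lra.
(* For [e <= 1] the difference of squares is at most [e * (2 * radius A + 1)], hence at most
   [d ^+ 2 / 8]. *)
pose e0 := d ^+ 2 / (8 * (2 * radius A + 1)).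
have e00 : 0 < e0 by rewrite divr_gt0// exprn_gt0.
have e0E : e0 * (8 * (2 * radius A + 1)) = d ^+ 2 by rewrite divfK// gt_eqF.
have [e e_gt0 [e1 ee]] : exists2 e, 0 < e & e <= 1 /\ e <= e0.
  by exists (Num.min 1 e0); rewrite ?lt_min ?ltr01// !ge_min !lexx orbT.
exists e => // y z Ay Az; have h := admissible_mdist cA Ay Az.
rewrite -(@ltr_pXn2r _ 2) ?nnegrE ?mdist_ge0 ?(ltW d0)//.
nra.
Qed.

Lemma center_exists A : cofinal A -> exists x, is_center A x.
Proof.
move=> cA.
have [e e0|e e' e0 ee' y|d|x xP] := @cauchy_nested _ _ hadH
    (fun e => [set y | admissible A (radius A + e) y]).
- have [c [_ [y cy]] cr] := inf_adherent e0 (radius_has_inf A).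
  exists y; apply: filterS cy => n cy An.
  by rewrite (le_trans (cy An))// ltW.
- by apply: filterS => n ye An; rewrite (le_trans (ye An))// lerD2l.
- by move=> /(admissible_diam cA).
exists x => c rc.
pose e := (c - radius A) / 4; have e0 : 0 < e by rewrite /e; lra.
have [y /= ye xy] := xP e e e0 e0.
have := asym_dist asym (@aP y) (@aP x) => /cvgrPdist_lt/(_ _ e0).
apply: filterS2 ye => n ye + An.
rewrite distrC => /(le_lt_trans (ler_norm _)) h.
rewrite (metric_sym y) in h.
have h2 : mdist (a y n) (a x n) <= 2 * e by lra.
by have := mdist_le_add (ye An) h2; rewrite /e; lra.
Qed.

Lemma center_unique A x y :
  cofinal A -> is_center A x -> is_center A y -> x = y.
Proof.
move=> cA Ax Ay; apply: contrapT => /eqP; rewrite -mdist_gt0 => d0.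
have [e e0 h] := admissible_diam cA d0.
have er : radius A < radius A + e by lra.
by have := h x y (Ax _ er) (Ay _ er); rewrite ltxx.
Qed.

(* If the projection of [w n] on the n-th geodesic stayed away from [g_ n 0],
   then by convexity a fixed point [g s] with [s > 0] would be as good a
   center as [x], against uniqueness. *)
Lemma regular_weak_cvg A x (w' : forall n, H_ n) : cofinal A -> is_center A x ->
  (forall B, cofinal B -> B `<=` A -> radius B = radius A) ->
  (forall n, A n -> w' n = w n) -> (forall n, ~ A n -> w' n = a x n) ->
  weak_cvg tau w' x.
Proof.
move=> cA Ax regA w'A w'N; have r0 := radius_ge0 A.
split.
  have r1 : radius A < radius A + 1 by lra.
  have [N _ NP] := Ax _ r1.
  (* The reference sequence copies [w'] on the finitely many indices where the distance is not yet
     controlled. *)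
  exists (fun n => if (n < N)%N then w' n else a x n), x; split.
    apply: (seq_cvg_near (@aP x)) => e e0; exists N => // n /= Nn.
    by rewrite ltnNge Nn /= mdistxx ltW.
  exists (radius A + 1) => n; case: ltnP => nN; first by rewrite mdistxx; lra.
  have [An|nAn] := pselect (A n); first by rewrite w'A// NP.
  by rewrite w'N// mdistxx; lra.
move=> g_ g gg_ gg gcvg g0x; have [c0 c1] := gcvg.
have [t tP] := choice (fun n => geodesic_proj (w' n) (gg_ n)).
have z01 : 0 \in `[0, 1 : R] by rewrite in_itv /= lexx ler01.
have c0x : seq_cvg tau (fun n => g_ n 0) x by rewrite -g0x.
apply: (seq_cvg_near c0x) => e e0; apply: contrapT => /not_near_cofinal cB0.
have e20 : 0 < e / 2 by lra.
pose L n := mdist (g_ n 0) (g_ n 1).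
have LL : L @ \oo --> mdist (g 0) (g 1) by exact: (asym_dist asym c0 c1).
set l := mdist (g 0) (g 1) in LL.
have l0 : 0 <= l by exact: mdist_ge0.
have Ll : \forall n \near \oo, L n < l + 1 by apply: cvgr_lt LL _ _; lra.
(* Off [A], [w' n] is [a x n], which is near [g_ n 0], and so is its projection; hence the bad
   indices eventually lie in [A], and regularity keeps [x] a center of [B]. *)
pose B := [set n | A n /\ e < mdist (g_ n 0) (g_ n (t n))].
have cB : cofinal B.
  move=> N.
  have [n Nn [/= + nA]] := cofinal_near cB0 (seq_cvg_dist_lt (@aP x) c0x e20) N.
  have [t01 -> tmin] := tP n; move=> /negP; rewrite -ltNge => et.
  exists n => //; split => //; apply: contrapT => /w'N wn.
  have h := tmin _ z01; rewrite wn in h.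
  have := metric_triangle (g_ n 0) (a x n) (g_ n (t n)).
  by rewrite (metric_sym (g_ n 0) (a x n)); lra.
have BA : B `<=` A by move=> n [].
have Bx : is_center B x.
  move=> c; rewrite (regA B cB BA) => /Ax; apply: filterS => n h /BA; exact: h.
(* On [B], [t n * L n > e] with [L n < l + 1] eventually, so [s] is a uniform lower bound for [t n];
   the extra [e] ensures [s <= 1]. *)
pose s := e / (l + 1 + e).
have le0 : 0 < l + 1 + e by lra.
have sE : s * (l + 1 + e) = e by rewrite divfK// gt_eqF.
have s0 : 0 < s by rewrite divr_gt0.
have s01 : s \in `[0, 1].
  by rewrite in_itv /= (ltW s0) ler_pdivrMr//; lra.
have st : \forall n \near \oo, B n -> s <= t n.
  apply: filterS Ll => n Ln [_]; have [t01 _ _] := tP n.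
  rewrite gg_// sub0r normrN ger0_norm; last by case/andP: t01.
  rewrite -/(L n) => et; have t0 : 0 <= t n by case/andP: t01.
  rewrite leNgt; apply/negP => ts.
  have : 0 <= L n by exact: mdist_ge0.
  nra.
have gs : seq_cvg tau (fun n => g_ n s) (g s) by exact: geodesic_cvg_at.
have Bs : is_center B (g s).
  move=> c rc; pose d := (c - radius B) / 4.
  have d0 : 0 < d by rewrite /d; lra.
  have dr : radius B < radius B + d by lra.
  have cd : radius B + 2 * d < c by rewrite /d; lra.
  apply: (admissible_of_cvg cd gs).
  have := seq_cvg_dist_lt (@aP x) c0x d0.
  apply: filterS3 st (Bx _ dr) => n st wx ax Bn.
  have := mdist_le_add (wx Bn) (ltW ax) => w0.
  (* [g_ n s] lies between [g_ n 0] and the projection, and the latter is at least as close to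
     [w n]. *)
  suff : mdist (w n) (g_ n s) <= mdist (w n) (g_ n 0) by lra.
  have [t01 _ /(_ _ z01)] := tP n; rewrite (w'A _ (BA _ Bn)) => wt.
  have {}st := st Bn.
  have t0 : 0 < t n by lra.
  pose u := s / t n.
  have u0 : 0 <= u by rewrite divr_ge0 ?ltW.
  have u1 : u <= 1 by rewrite ler_pdivrMr// mul1r.
  have u01 : u \in `[0, 1] by rewrite in_itv /= u0.
  have := cat0_sub (hadH_ n) (w n) (gg_ n) z01 t01 u01.
  rewrite (_ : (1 - u) * 0 + u * t n = s); last first.
    by rewrite mulr0 add0r divfK// gt_eqF.
  move=> h; rewrite -ler_sqr ?nnegrE ?mdist_ge0//.
  move: wt; rewrite -ler_sqr ?nnegrE ?mdist_ge0// => wt.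
  have : 0 <= u * (1 - u) * mdist (g_ n 0) (g_ n (t n)) ^+ 2.
    by apply: mulr_ge0; [apply: mulr_ge0; lra | exact: sqr_ge0].
  nra.
(* [g s = g 0] with [s > 0] forces [l = 0], so [L n] drops below [e], against the definition of
   [B]. *)
have xs := center_unique cB Bx Bs.
have := gg 0 s z01 s01.
rewrite -xs g0x mdistxx sub0r normrN gtr0_norm// -g0x -/l.
move=> /esym/eqP; rewrite mulf_eq0 gt_eqF//= => /eqP le.
have Le : \forall n \near \oo, L n < e by apply: cvgr_lt LL _ _; rewrite le.
have [n [_ ]] := cofinal_ex cB Le; have [t01 _ _] := tP n.
rewrite gg_// sub0r normrN => + Ln; apply/negP; rewrite -leNgt -/(L n).
move: t01; rewrite in_itv /= => /andP[t0 t1]; rewrite ger0_norm//.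
have : 0 <= L n by exact: mdist_ge0.
nra.
Qed.

End Centers.

Lemma bounded_weak_cvg (A0 : set nat) (w u : forall n, H_ n) (y : H) (M : R) :
  cofinal A0 -> seq_cvg tau u y -> (forall n, mdist (w n) (u n) <= M) ->
  exists (A : set nat) w' z, [/\ cofinal A, A `<=` A0,
    forall n, A n -> w' n = w n & weak_cvg tau w' z].
Proof.
move=> cA0 uy wu.
have [a aP] := choice (asym_dense asym).
have wb : exists c y, admissible a w setT c y.
  exists (M + 1), y; apply: (admissible_of_cvg aP (c := M) _ uy); first by lra.
  by apply: nearW => n _; exact: wu.
have [A [cA AA0 regA]] :=
  regular_subset (radius_ge0 wb) (radius_mono wb) cA0.
have [z Az] := center_exists aP wb cA.
exists A, (fun n => if pselect (A n) then w n else a z n), z; split => //.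
  by move=> n An; case: pselect.
by apply: (regular_weak_cvg aP wb cA Az regA) => n An; case: pselect.
Qed.

End Asymptotic.

(** * Mosco convergence *)

Lemma limn_einf_le_cofinal (R : realType) (u : nat -> \bar R) (A : set nat)
    (b : \bar R) : cofinal A -> (\forall n \near \oo, A n -> (u n <= b)%E) ->
  (limn_einf u <= b)%E.
Proof.
move=> cA ub; rewrite [limn_einf u]limf_einfE.
apply: ge_ereal_sup => _ [V VF <-].
have [n An [unb Vn]] := cofinal_ex cA (filterI ub VF).
by apply: le_trans (unb An); apply: ereal_inf_lbound; exists n.
Qed.

(** When [D - d] is not positive it cannot be squared, but then the left side is nonpositive. *)
Lemma sqr_lower_bound (R : realFieldType) (D d v : R) :
  0 <= D -> 0 <= d -> 0 <= v -> D - d <= v -> D ^+ 2 - 2 * d * D <= v ^+ 2.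
Proof.
move=> D0 d0 v0 Dv; have [Dd|dD] := leP D d; last by nra.
by have := sqr_ge0 v; nra.
Qed.

Section MoscoResolvent.
Context {R : realType} {H : metricType R} {H_ : nat -> metricType R}.
Variables (hadH : hadamard H) (hadH_ : forall n : nat, hadamard (H_ n)).
Variables (tau : dunion_topology H_ H) (asym : asymptotic_relation tau).
Variables (f : H -> \bar R) (f_ : forall n : nat, H_ n -> \bar R).
Arguments f_ : clear implicits.
Hypotheses (hf : proper_convex_lsc f).
Hypotheses (hf_ : forall n : nat, proper_convex_lsc (f_ n)).
Variables (x : H) (x_ : forall n : nat, H_ n) (hx : seq_cvg tau x_ x).
Hypothesis hmosco : mosco_cvg tau f_ f.
Variables (lambda : R) (l0 : 0 < lambda).
Local Notation k := ((2 * lambda)^-1).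
Local Notation F_ n := (prox_obj (f_ n) lambda (x_ n)).

Let k0 : 0 < k. Proof. by rewrite invr_gt0 mulr_gt0. Qed.

(** (M2) controls [f_ n] and (A3) the quadratic term. *)
Lemma mosco_recovery (m : R) (p : H) :
  prox_obj f lambda x p = m%:E ->
  exists2 y_, seq_cvg tau y_ p &
    forall e, 0 < e -> \forall n \near \oo, (F_ n (y_ n) <= (m + e)%:E)%E.
Proof.
move=> Fp; have [_ [y_ yp fy]] := hmosco p; exists y_ => // e e0.
have fp : f p \is a fin_num.
  by move: Fp; rewrite /prox_obj; case: (f p).
have [c fpE] : exists c, f p = c%:E by exists (fine (f p)); rewrite fineK.
move: Fp fy; rewrite /prox_obj fpE -EFinD => -[cm] /fine_cvgP[ffin fy].
have ku : (fun n => k * mdist (x_ n) (y_ n) ^+ 2) @ \oo --> k * mdist x p ^+ 2.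
  by apply: cvgM; [exact: cvg_cst | apply/cvg_sqr/(asym_dist asym hx yp)].
have h1 : c < c + e / 2 by lra.
have h2 : k * mdist x p ^+ 2 < k * mdist x p ^+ 2 + e / 2 by lra.
apply: filterS3 ffin (cvgr_lt _ fy _ h1) (cvgr_lt _ ku _ h2) => n.
by move=> /fineK <- /= fn kn; rewrite lee_fin; lra.
Qed.

Lemma mosco_weak_liminf (A0 : set nat) (w u_ : forall n, H_ n) (u : H)
    (M b m : R) : cofinal A0 -> seq_cvg tau u_ u ->
  (forall n, mdist (w n) (u_ n) <= M) ->
  (\forall n \near \oo, A0 n -> (F_ n (w n) <= b%:E)%E) ->
  (forall z, (m%:E <= prox_obj f lambda x z)%E) -> m <= b.
Proof.
move=> cA0 uu wu wb mF; rewrite leNgt; apply/negP => bm.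
have [A [w' [z [cA AA0 w'A wz]]]] :=
  bounded_weak_cvg hadH hadH_ asym cA0 uu wu.
set e := m - b; have e0 : 0 < e by rewrite /e; lra.
pose D := mdist z x; have D0 : 0 <= D by exact: mdist_ge0.
(* Chosen so that the error [2 * k * d * D] stays below [e / 2]; the objective at [z] is then at
   most [b + e / 2 < m]. *)
pose d := e / (4 * k * (D + 1)).
have dd0 : 0 < 4 * k * (D + 1) by rewrite !mulr_gt0//; lra.
have d0 : 0 < d by rewrite divr_gt0.
have dE : d * (4 * k * (D + 1)) = e by rewrite divfK// gt_eqF.
have fz : (f z <= (b + e / 2 - k * D ^+ 2)%:E)%E.
  have [+ _] := hmosco z; move=> /(_ _ wz) /le_trans; apply.
  apply: (limn_einf_le_cofinal cA).
  apply: filterS2 wb (weak_cvg_dist hadH hadH_ asym wz hx d0) => n wb Dw An.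
  rewrite (w'A _ An) in Dw *; move: (wb (AA0 _ An)).
  rewrite /prox_obj -leeBrDr// -EFinB => /le_trans; apply; rewrite lee_fin.
  have wx0 := mdist_ge0 (w n) (x_ n).
  have := ler_wpM2l (ltW k0) (sqr_lower_bound D0 (ltW d0) wx0 Dw).
  rewrite (metric_sym (w n)).
  have : 0 < d * k by rewrite mulr_gt0.
  nra.
have := mF z; apply/negP; rewrite -ltNge.
apply: (@le_lt_trans _ _ (b + e / 2)%:E); last by rewrite lte_fin /e; lra.
by rewrite /prox_obj -leeBrDr// -EFinB metric_sym.
Qed.

Lemma near_moreau_env_ge (m : R) (m_ : nat -> R) :
  moreau_env f lambda x = m%:E ->
  (forall n, moreau_env (f_ n) lambda (x_ n) = (m_ n)%:E) ->
  forall e, 0 < e -> \forall n \near \oo, m - e <= m_ n.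
Proof.
move=> mE m_E e e0.
have [m' [m'E Fp mF]] := resolventP hadH hf l0 x.
have mm : m' = m by apply: EFin_inj; rewrite -m'E.
rewrite mm in Fp mF.
have [y_ yp Fy] := mosco_recovery Fp.
apply: contrapT => /not_near_cofinal cA0.
have [g_ g_P] := geodesics_between hadH_ y_
  (fun n => resolvent (f_ n) lambda (x_ n)).
(* The minimizers might be unbounded; the point at parameter [t n] of the
   geodesic towards them is at distance at most 1/2 from [y_ n], and by strong
   convexity the objective still drops there by a definite amount. *)
pose d n := mdist (y_ n) (resolvent (f_ n) lambda (x_ n)).
pose t n := (2 * Num.max 1 (d n))^-1.
have max1 n : 1 <= Num.max 1 (d n) by rewrite le_max lexx.
have t0 n : 0 < t n by rewrite invr_gt0 mulr_gt0// (lt_le_trans _ (max1 n)).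
have tE n : t n * Num.max 1 (d n) = 1 / 2.
  rewrite /t; field; rewrite gt_eqF// (lt_le_trans _ (max1 n))//.
have t1 n : t n <= 1 / 2 by rewrite -(tE n); have := max1 n; have := t0 n; nra.
have t01 n : t n \in `[0, 1].
  by rewrite in_itv /= (ltW (t0 n)); have := t1 n; lra.
(* If [d n <= 1], then [t n = 1 / 2] and the linear part drops by [e / 2] up to [e' / 2]; otherwise
   the quadratic term is at least [k / 4]. Both leave a value of at most [m - e']. *)
have [e' e'0 [e'e e'k]] : exists2 e', 0 < e' & e' <= e / 4 /\ e' <= k / 8.
  exists (Num.min (e / 4) (k / 8)); last by rewrite !ge_min !lexx orbT.
  by rewrite lt_min !divr_gt0.
have wu n : mdist (g_ n (t n)) (y_ n) <= 1.
  have [gg g0 g1] := g_P n.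
  have z01 : 0 \in `[0, 1 : R] by rewrite in_itv /= lexx ler01.
  rewrite -g0 (gg _ _ (t01 n) z01).
  rewrite g0 g1 -/(d n) subr0 gtr0_norm// (@le_trans _ _ (1 / 2))//; last lra.
  by rewrite -(tE n) ler_wpM2l ?(ltW (t0 n))// le_max lexx orbT.
have : m <= m - e'; last by lra.
apply: (mosco_weak_liminf cA0 yp wu _ mF).
apply: filterS (Fy _ e'0) => n Fyn /= /negP; rewrite -ltNge => mn.
have [gg g0 g1] := g_P n.
have [m2 [m2E Fz _]] := resolventP (hadH_ n) (hf_ n) l0 (x_ n).
have mm' : m2 = m_ n by apply: EFin_inj; rewrite -m2E.
rewrite mm' -g1 in Fz; rewrite -g0 in Fyn.
have Fzn : (F_ n (g_ n 1%R) <= (m - e)%:E)%E by rewrite Fz lee_fin ltW.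
have := prox_obj_geodesic (hadH_ n) l0 (pcl_convex (hf_ n)) gg (t01 n) Fyn Fzn.
move=> /le_trans; apply; rewrite lee_fin g0 g1 -/(d n).
have := tE n; have [d1|d1] := leP (d n) 1.
  rewrite mulr1 => tn.
  have : 0 <= k * (t n * (1 - t n) * d n ^+ 2).
    by rewrite tn mulr_ge0 ?(ltW k0)// mulr_ge0 ?sqr_ge0//; lra.
  rewrite tn; lra.
move=> td.
have -> : k * (t n * (1 - t n) * d n ^+ 2) = k * (t n * d n) * d n * (1 - t n).
  by ring.
rewrite td.
have h1 : 1 / 2 <= d n * (1 - t n) by have := t1 n; nra.
have := ler_wpM2l (ltW k0) h1; have := t0 n; have := t1 n.
nra.
Qed.

End MoscoResolvent.

Theorem theorem4p5 (R : realType) (H : metricType R) (H_ : nat -> metricType R)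
    (hadH : hadamard H) (hadH_ : forall n : nat, hadamard (H_ n))
    (tau : dunion_topology H_ H) (asym : asymptotic_relation tau)
    (f : H -> \bar R) (f_ : forall n : nat, H_ n -> \bar R)
    (hf : proper_convex_lsc f) (hf_ : forall n : nat, proper_convex_lsc (f_ n))
    (x : H) (x_ : forall n : nat, H_ n) (hx : seq_cvg tau x_ x)
    (hmosco : mosco_cvg tau f_ f) :
  forall lambda : R, 0 < lambda ->
    ((fun n : nat => moreau_env (f_ n) lambda (x_ n)) @ \oo
       --> moreau_env f lambda x) /\
    seq_cvg tau (fun n : nat => resolvent (f_ n) lambda (x_ n))
      (resolvent f lambda x).
Proof.
move=> lambda l0.
have [m [mE Fp mF]] := resolventP hadH hf l0 x.
have [m_ m_P] := choice (fun n => resolventP (hadH_ n) (hf_ n) l0 (x_ n)).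
have m_E n : moreau_env (f_ n) lambda (x_ n) = (m_ n)%:E by case: (m_P n).
have [y_ yp Fy] := mosco_recovery asym hx hmosco Fp.
have lo := near_moreau_env_ge hadH hadH_ asym hf hf_ hx hmosco l0 mE m_E.
split.
  rewrite mE; apply/fine_cvgP; split; first by apply: nearW => n; rewrite m_E.
  apply/cvgrPdist_le => e e0; apply: filterS2 (lo e e0) (Fy e e0) => n mn Fyn.
  have [_ _ /(_ (y_ n)) /le_trans/(_ Fyn)] := m_P n; rewrite lee_fin => nm.
  by rewrite /= m_E /= ler_norml; apply/andP; split; lra.
apply: (seq_cvg_near asym yp) => e e0.
have k0 : 0 < (2 * lambda)^-1 by rewrite invr_gt0 mulr_gt0.
(* This margin enters twice, above at [y_ n] and below in the envelope, which matches the factor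
   [k / 2] of the quadratic growth with [k = (2 * lambda)^-1]. *)
have e'0 : 0 < (2 * lambda)^-1 * e ^+ 2 / 4.
  by rewrite divr_gt0// mulr_gt0// exprn_gt0.
apply: filterS2 (lo _ e'0) (Fy _ e'0) => n mn Fyn.
have := resolvent_quadratic_growth (hadH_ n) (hf_ n) l0 (m_E n) Fyn.
rewrite metric_sym => h.
rewrite -ler_sqr ?nnegrE ?mdist_ge0 ?(ltW e0)//.
by rewrite -(ler_pM2l k0); lra.
Qed.
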